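(* Let $\alpha : I \to \mathbb{R}^3$ be a curve parametrized by arc length, with curvature greater than zero. Then [$\alpha$ is a rectifying curve or $\alpha(I)$ is contained in a sphere centered at the origin] if and only if the vector field $\alpha \times \frac{d\alpha}{ds}$ has constant nonzero magnitude along $I$.
   Context: $I\subseteq\mathbb{R}$ is an open interval and curves are smooth; $\times$ is the cross product of Euclidean space $\mathbb{R}^3$. For a unit speed curve $\alpha$ with positive curvature $\kappa$, its Frenet frame is $\mathbf{t}=\alpha'$, $\mathbf{n}=\alpha''/\kappa$ (principal normal), $\mathbf{b}=\mathbf{t}\times\mathbf{n}$. The rectifying plane at $\alpha(s)$ is the plane spanned by $\mathbf{t}(s)$ and $\mathbf{b}(s)$. A unit speed curve $\alpha$ with positive curvature is called a rectifying curve if its position vector always lies in its rectifying plane, i.e. $\alpha(s)\in\operatorname{span}\{\mathbf{t}(s),\mathbf{b}(s)\}$ for all $s\in I$ (equivalently $\langle \alpha(s),\mathbf{n}(s)\rangle=0$ for all $s\in I$). A sphere centered at the origin has positive radius. *)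

(* Defs.v *)
From HB Require Import structures.
From mathcomp Require Import all_boot all_order all_algebra.
From mathcomp Require Import all_classical all_reals all_analysis.
Import Order.TTheory GRing.Theory Num.Theory.
Import numFieldNormedType.Exports.

Set Implicit Arguments.
Unset Strict Implicit.
Unset Printing Implicit Defensive.

Local Open Scope ring_scope.
Local Open Scope classical_set_scope.

Section Curves.
Context {R : realType}.
Implicit Types (u v : 'rV[R]_3) (I : set R) (alpha : R -> 'rV[R]_3).

(* Index arithmetic is in 'I_3, hence modulo 3. *)
Definition crossmul u v : 'rV[R]_3 :=
  \row_(i < 3) (u 0 (i + 1) * v 0 (i + 2) - u 0 (i + 2) * v 0 (i + 1)).

(* The library norm `|u| on row vectors is the max norm. *)
Definition enorm u : R := Num.sqrt (\sum_(i < 3) u 0 i ^+ 2).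

Definition origin_sphere (r : R) : set 'rV[R]_3 := [set u | enorm u = r].

Definition open_interval I : Prop := [/\ I !=set0, open I & is_interval I].

(* A curve on I is represented by a total function; I is open in all uses, so
   derivatives at points of I do not depend on the values outside I. *)
Definition smooth_on I alpha : Prop :=
  forall (n : nat) (s : R), I s -> derivable (derive1n n alpha) s 1.

Definition unit_speed I alpha : Prop :=
  forall s, I s -> enorm (derive1 alpha s) = 1.

(* These formulas are the curvature and Frenet frame only for unit speed curves. *)
Definition curvature alpha (s : R) : R := enorm (derive1n 2 alpha s).

Definition tangent alpha (s : R) : 'rV[R]_3 := derive1 alpha s.

Definition normal alpha (s : R) : 'rV[R]_3 :=
  (curvature alpha s)^-1 *: derive1n 2 alpha s.

Definition binormal alpha (s : R) : 'rV[R]_3 :=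
  crossmul (tangent alpha s) (normal alpha s).

Definition positive_curvature I alpha : Prop :=
  forall s, I s -> 0 < curvature alpha s.

Definition rectifying_plane alpha (s : R) : {vspace 'rV[R]_3} :=
  <<[:: tangent alpha s; binormal alpha s]>>%VS.

Definition rectifying_curve I alpha : Prop :=
  [/\ smooth_on I alpha, unit_speed I alpha, positive_curvature I alpha &
      forall s, I s -> alpha s \in rectifying_plane alpha s].

End Curves.

(* Main.v *)
(* Put g = <alpha, alpha'> and h = <alpha, alpha''>. For a unit speed curve
   g' = 1 + h and |alpha x alpha'|^2 = |alpha|^2 - g^2, whose derivative is
   -2 g h; so the magnitude is constant iff g h = 0 on I. Rectifying curves are
   those with h = 0, spherical ones those with g = 0, and g h = 0 forces one of
   the two on the whole of I because h can only take the values 0 and -1. *)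

Require Import Defs.
From HB Require Import structures.
From mathcomp Require Import all_boot all_order all_algebra.
From mathcomp Require Import all_classical all_reals all_analysis.
From mathcomp Require Import ring.
Import Order.TTheory GRing.Theory Num.Theory.
Import numFieldNormedType.Exports.

Set Implicit Arguments.
Unset Strict Implicit.

Local Open Scope ring_scope.
Local Open Scope classical_set_scope.

(** * Dot and cross products in Euclidean 3-space *)

Definition dot {R : realType} (u v : 'rV[R]_3) : R :=
  \sum_(i < 3) u 0 i * v 0 i.

Section EuclideanSpace.
Context {R : realType}.
Implicit Types (a : R) (u v w : 'rV[R]_3).

Lemma dotE u v : dot u v = u 0 0 * v 0 0 + u 0 1 * v 0 1 + u 0 2 * v 0 2.
Proof.
rewrite /dot !big_ord_recl big_ord0 addr0 addrA.
by congr (u 0 _ * v 0 _ + u 0 _ * v 0 _ + u 0 _ * v 0 _); apply: val_inj.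
Qed.

Lemma crossmulE u v :
  [/\ crossmul u v 0 0 = u 0 1 * v 0 2 - u 0 2 * v 0 1,
      crossmul u v 0 1 = u 0 2 * v 0 0 - u 0 0 * v 0 2 &
      crossmul u v 0 2 = u 0 0 * v 0 1 - u 0 1 * v 0 0].
Proof.
split; rewrite mxE; congr (u 0 _ * v 0 _ - u 0 _ * v 0 _); exact: val_inj.
Qed.

Lemma row3P u v :
  [/\ u 0 0 = v 0 0, u 0 1 = v 0 1 & u 0 2 = v 0 2] -> u = v.
Proof.
move=> [e0 e1 e2]; apply/rowP => -[[|[|[|//]]] hi].
- by rewrite (_ : Ordinal hi = 0) //; apply: val_inj.
- by rewrite (_ : Ordinal hi = 1) //; apply: val_inj.
- by rewrite (_ : Ordinal hi = 2) //; apply: val_inj.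
Qed.

Lemma dotC u v : dot u v = dot v u.
Proof. by rewrite !dotE; ring. Qed.

Lemma dotDl u v w : dot (u + v) w = dot u w + dot v w.
Proof. by rewrite !dotE !mxE; ring. Qed.

Lemma dotZl a u v : dot (a *: u) v = a * dot u v.
Proof. by rewrite !dotE !mxE; ring. Qed.

Lemma dotBl u v w : dot (u - v) w = dot u w - dot v w.
Proof. by rewrite !dotE !mxE; ring. Qed.

Lemma dot_ge0 u : 0 <= dot u u.
Proof. by rewrite sumr_ge0 // => i _; rewrite -expr2 sqr_ge0. Qed.

Lemma dot_eq0 u : (dot u u == 0) = (u == 0).
Proof.
apply/eqP/eqP => [|->]; last by rewrite dotE !mxE; ring.
move=> /psumr_eq0P u0; apply/rowP => i; rewrite mxE.
have := u0 (fun i _ => _) i isT; rewrite -expr2 => /(_ _)/eqP.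
by rewrite sqrf_eq0 => h; apply/eqP/h => j; rewrite -expr2 sqr_ge0.
Qed.

Lemma enormE u : enorm u = Num.sqrt (dot u u).
Proof. by rewrite /enorm /dot; under eq_bigr do rewrite expr2. Qed.

Lemma enorm_ge0 u : 0 <= enorm u.
Proof. exact: sqrtr_ge0. Qed.

Lemma sqr_enorm u : enorm u ^+ 2 = dot u u.
Proof. by rewrite enormE sqr_sqrtr ?dot_ge0. Qed.

Lemma enorm_eq u a : 0 <= a -> enorm u ^+ 2 = a ^+ 2 -> enorm u = a.
Proof. by move=> a0 /eqP; rewrite eqrXn2 ?enorm_ge0 // => /eqP. Qed.

(** Lagrange's identity. *)
Lemma dot_crossmul u v :
  dot (crossmul u v) (crossmul u v) = dot u u * dot v v - dot u v ^+ 2.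
Proof. by rewrite !dotE; have [-> -> ->] := crossmulE u v; ring. Qed.

Lemma dot_crossmulr u v : dot (crossmul u v) v = 0.
Proof. by rewrite dotE; have [-> -> ->] := crossmulE u v; ring. Qed.

(** Cramer's rule for the coordinates of [w] in the frame [u], [v], [u x v]. Multiplying through by
    the Gram determinant [|u x v|^2] leaves a polynomial identity, valid even for dependent [u] and
    [v]. *)
Lemma crossmul_frame u v w :
  dot (crossmul u v) (crossmul u v) *: w =
    dot w (crossmul u v) *: crossmul u v
    + (dot w u * dot v v - dot w v * dot u v) *: u
    + (dot w v * dot u u - dot w u * dot u v) *: v.
Proof.
have [] := crossmulE u v; move: (crossmul u v) => p p0 p1 p2.
by apply: row3P; rewrite !dotE !mxE p0 p1 p2; split; ring.
Qed.

(** Here [u], [v], [u x v] form an orthogonal basis, so the plane of [u] and [u x v] is the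
    orthogonal complement of [v]. For the tangent and the normal this is the rectifying plane. *)
Lemma mem_span_crossmul u v w : dot u v = 0 -> u != 0 -> v != 0 ->
  (w \in <<[:: u; crossmul u v]>>%VS) = (dot w v == 0).
Proof.
move=> uv u0 v0; rewrite span_cons span_seq1; apply/idP/eqP.
  case/memv_addP => _ /vlineP[a ->] [_ /vlineP[b ->] ->].
  by rewrite dotDl !dotZl uv dot_crossmulr !mulr0 addr0.
move=> wv; have := crossmul_frame u v w.
rewrite uv wv !mulr0 mul0r !subr0 scale0r addr0 => e.
have n0 : dot (crossmul u v) (crossmul u v) != 0.
  by rewrite dot_crossmul uv expr0n subr0 mulf_neq0 ?dot_eq0.
rewrite -(scalerK n0 w) e memvZ // addrC memv_add //; exact/memvZ/memv_line.
Qed.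

End EuclideanSpace.

(** * Differentiation on an open interval *)

Section Calculus.
Context {R : realType}.
Implicit Types (I : set R) (f df g : R -> R) (u v : R -> 'rV[R]_3).

Lemma is_derive_dot u v s : derivable u s 1 -> derivable v s 1 ->
  is_derive s 1 (fun x => dot (u x) (v x))
    (dot (derive1 u s) (v s) + dot (u s) (derive1 v s)).
Proof.
move=> du dv.
have cu i : is_derive s 1 (fun x => u x 0 i) (derive1 u s 0 i).
  rewrite derive1E derive_mx // mxE.
  exact/derivableP/((derivable_mxP _ _ _).1 du 0 i).
have cv i : is_derive s 1 (fun x => v x 0 i) (derive1 v s 0 i).
  rewrite derive1E derive_mx // mxE.
  exact/derivableP/((derivable_mxP _ _ _).1 dv 0 i).
(* As a sum of products of coordinate functions, the dot product is differentiated by instance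
   inference from [cu] and [cv]. *)
have -> : (fun x => dot (u x) (v x)) =
    \sum_(i < 3) ((fun x => u x 0 i) * (fun x => v x 0 i)).
  by apply/funext => x; rewrite fct_sumE.
apply: is_derive_eq.
rewrite /dot -big_split; apply: eq_bigr => i _ /=.
by rewrite addrC; congr (_ + _); exact: mulrC.
Qed.

(** Mean value theorem on the segment between the two points, which lies in [I] because [I] is an
    interval. *)
Lemma is_derive0_cst I f : is_interval I ->
  (forall s, I s -> is_derive s 1 f 0) -> forall x y, I x -> I y -> f x = f y.
Proof.
move=> itvI df x y; wlog xy : x y / x <= y => [hw Ix Iy|Ix Iy].
  by case/orP: (le_total x y) => /hw xy; [exact: xy|rewrite xy].
have dI z : z \in `[x, y]%R -> is_derive z 1 f 0.
  by rewrite in_itv => xzy; exact/df/(itvI x y).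
have dO z : z \in `]x, y[%R -> is_derive z 1 f ((fun=> 0) z).
  by move/subset_itv_oo_cc/dI.
have cf : {within `[x, y], continuous f}.
  by apply: derivable_within_continuous => z /dI[].
by have [z _] := MVT_segment xy dO cf; rewrite mul0r => /subr0_eq.
Qed.

(** This allows an identity that holds on [I] to be differentiated: since [I] is open, [f] agrees
    with a constant near [s]. *)
Lemma derive_cst_on I f c s d : open I -> (forall x, I x -> f x = c) ->
  I s -> is_derive s 1 f d -> d = 0.
Proof.
move=> oI fc Is df.
have nI : \near s, f s = cst c s.
  by apply: filterS (open_nbhs_nbhs (conj oI Is)) => x /fc.
have := @near_eq_is_derive _ _ _ _ _ _ _ _ nI df.
by move=> h; rewrite -(@derive_val _ _ _ _ _ _ _ h) derive_cst.
Qed.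

End Calculus.

(** * Unit speed curves with positive curvature *)

Section UnitSpeedCurve.
Context {R : realType}.
Variables (I : set R) (alpha : R -> 'rV[R]_3).
Hypotheses (hI : open_interval I) (hsmooth : smooth_on I alpha).
Hypotheses (hspeed : unit_speed I alpha) (hcurv : positive_curvature I alpha).

(** [D 0 s] and [D 1 s] are convertible to [alpha s] and [derive1 alpha s]; the uniform notation
    lets one product rule serve all orders. *)
Local Notation D n s := (derive1n n alpha s).
Local Notation g := (fun s => dot (D 0 s) (D 1 s)).
Local Notation h := (fun s => dot (D 0 s) (D 2 s)).

Let oI : open I. Proof. by case: hI. Qed.
Let itvI : is_interval I. Proof. by case: hI. Qed.

Lemma is_derive_dot_derive1n m n s : I s ->
  is_derive s 1 (fun x => dot (D m x) (D n x))
    (dot (D m.+1 s) (D n s) + dot (D m s) (D n.+1 s)).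
Proof.
by move=> Is; exact: is_derive_dot (@hsmooth m s Is) (@hsmooth n s Is).
Qed.

Lemma tangent_unit s : I s -> dot (D 1 s) (D 1 s) = 1.
Proof. by move=> /hspeed e; rewrite -sqr_enorm [enorm _]e expr1n. Qed.

Lemma acceleration_neq0 s : I s -> D 2 s != 0.
Proof.
by move=> /hcurv; rewrite -dot_eq0 -sqr_enorm sqrf_eq0 => /lt0r_neq0.
Qed.

(** Differentiate [<alpha', alpha'> = 1]. *)
Lemma tangent_acceleration s : I s -> dot (D 1 s) (D 2 s) = 0.
Proof.
move=> Is; have := is_derive_dot_derive1n 1 1 Is.
move=> /(derive_cst_on oI tangent_unit Is).
by rewrite (dotC (D 2 s)) -mulr2n => /eqP; rewrite mulrn_eq0 => /eqP.
Qed.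

Lemma is_derive_tangential s : I s -> is_derive s 1 g (1 + h s).
Proof.
by move=> Is; have := is_derive_dot_derive1n 0 1 Is; rewrite (tangent_unit Is).
Qed.

Lemma is_derive_acceleration_component s : I s ->
  is_derive s 1 h (dot (D 0 s) (D 3 s)).
Proof.
move=> Is; have := is_derive_dot_derive1n 0 2 Is.
by rewrite (tangent_acceleration Is) add0r.
Qed.

Lemma enorm_cross s : I s ->
  enorm (crossmul (D 0 s) (D 1 s)) ^+ 2 = dot (D 0 s) (D 0 s) - g s ^+ 2.
Proof.
by move=> Is; rewrite sqr_enorm dot_crossmul (tangent_unit Is) mulr1.
Qed.

(** The square is used because the square root is not differentiable at 0. The derivative arises as
    [2 g - 2 g (1 + h)]. *)
Lemma is_derive_sqr_enorm_cross s : I s ->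
  is_derive s 1 (fun x => dot (D 0 x) (D 0 x) - g x ^+ 2) (- (2 * (g s * h s))).
Proof.
move=> Is; have Dg := is_derive_tangential Is.
have Da := is_derive_dot_derive1n 0 0 Is.
apply: is_derive_eq (is_deriveB Da (is_deriveX 2 Dg)) _.
rewrite (dotC (D 1 s)) /GRing.scale /=.
move: (dot _ (D 1 s)) (dot _ (D 2 s)) => x y; ring.
Qed.

(** Positive curvature makes the normal a nonzero multiple of [alpha''], so orthogonality of [alpha]
    to either is the same condition. *)
Lemma rectifyingE :
  rectifying_curve I alpha <-> forall s, I s -> h s = 0.
Proof.
have rectE s : I s -> (alpha s \in rectifying_plane alpha s) = (h s == 0).
  move=> Is; have k0 : (curvature alpha s)^-1 != 0.
    by rewrite invr_eq0 gt_eqF ?hcurv.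
  have uv : dot (tangent alpha s) (normal alpha s) = 0.
    by rewrite dotC dotZl dotC [dot _ _](tangent_acceleration Is) mulr0.
  have u0 : tangent alpha s != 0.
    by rewrite -dot_eq0 [dot _ _](tangent_unit Is) oner_neq0.
  have v0 : normal alpha s != 0.
    by rewrite scaler_eq0 negb_or k0 acceleration_neq0.
  rewrite [LHS](mem_span_crossmul (alpha s) uv u0 v0).
  by rewrite dotC dotZl dotC mulf_eq0 (negbTE k0).
split=> [[_ _ _ rect] s Is|h0].
  by apply/eqP; rewrite -(rectE s Is); exact: rect.
by split=> // s Is; rewrite (rectE s Is); apply/eqP; exact: h0.
Qed.

Lemma enorm_cross_cst x y : (forall s, I s -> g s * h s = 0) -> I x -> I y ->
  enorm (crossmul (D 0 x) (D 1 x)) = enorm (crossmul (D 0 y) (D 1 y)).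
Proof.
move=> gh0 Ix Iy; apply: enorm_eq (enorm_ge0 _) _.
apply: etrans (enorm_cross Ix) (etrans _ (esym (enorm_cross Iy))).
have dF s : I s ->
    is_derive s 1 (fun x => dot (D 0 x) (D 0 x) - g x ^+ 2) 0.
  move=> Is; apply: is_derive_eq (is_derive_sqr_enorm_cross Is) _.
  by rewrite (gh0 s Is) mulr0 oppr0.
exact: is_derive0_cst itvI dF x y Ix Iy.
Qed.

(* If [alpha] and [alpha'] are parallel then [alpha = g alpha']; differentiating
   [h = 0] and [<alpha', alpha''> = 0] turns this into [g |alpha''|^2 = 0],
   contradicting [g' = 1]. *)
Lemma rectifying_enorm_cross_neq0 : (forall s, I s -> h s = 0) ->
  ~ (forall s, I s -> enorm (crossmul (D 0 s) (D 1 s)) = 0).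
Proof.
move=> h0 c0.
have aE s : I s -> D 0 s = g s *: D 1 s.
  (* As [alpha'] is a unit vector, [alpha - g alpha'] has squared length [|alpha|^2 - g^2], which is
     the squared magnitude of the cross product. *)
  move=> Is; apply/eqP; rewrite -subr_eq0 -dot_eq0; apply/eqP.
  have := enorm_cross Is; rewrite (c0 s Is) expr0n; have := tangent_unit Is.
  move: (D 0 s) (D 1 s) => u v vv /= e.
  rewrite dotBl dotZl !(dotC _ (u - _)) !dotBl !dotZl vv (dotC v u).
  by rewrite [RHS]e; ring.
have g0 s : I s -> g s = 0.
  move=> Is; have := derive_cst_on oI h0 Is (is_derive_acceleration_component Is).
  rewrite {1}(aE s Is) dotZl => /eqP; rewrite mulf_eq0 => /orP[/eqP//|/eqP TB].
  have := is_derive_dot_derive1n 1 2 Is.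
  move=> /(derive_cst_on oI tangent_acceleration Is).
  by rewrite TB addr0 => /eqP; rewrite dot_eq0 (negbTE (acceleration_neq0 Is)).
have [[s Is] _ _] := hI.
have := derive_cst_on oI g0 Is (is_derive_tangential Is).
by rewrite (h0 s Is) addr0 => /eqP; rewrite oner_eq0.
Qed.

(* Where [h <> 0], [g] vanishes identically nearby, so [0 = g' = 1 + h]: thus
   [h] takes only the values [0] and [-1], and being continuous is constant. *)
Lemma acceleration_component_cst : (forall s, I s -> g s * h s = 0) ->
  (forall s, I s -> h s = 0) \/ (forall s, I s -> h s = -1).
Proof.
move=> gh0; pose dh s := dot (D 0 s) (D 3 s).
have Dh s : I s -> is_derive s 1 h (dh s).
  exact: is_derive_acceleration_component.
(* Differentiating [g h = 0] gives [(1 + h) h + g h' = 0]. At each point either [h = 0], or [g = 0]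
   and the second term drops out. *)
have hh s : I s -> h s * (1 + h s) = 0.
  move=> Is; have Dgh := is_deriveM (is_derive_tangential Is) (Dh s Is).
  have := derive_cst_on oI gh0 Is Dgh; have := gh0 s Is; rewrite /GRing.scale /=.
  move: (dot _ (D 1 s)) (dot _ (D 2 s)) (dh s) => x y z /eqP.
  by rewrite mulf_eq0 => /orP[]/eqP ->; rewrite mul0r ?add0r.
have dh0 s : I s -> dh s = 0.
  move=> Is; have := hh s Is.
  have D1h := is_deriveD (is_derive_cst (1 : R^o) s 1) (Dh s Is).
  have := derive_cst_on oI hh Is (is_deriveM (Dh s Is) D1h).
  rewrite /GRing.scale /= fctE; move: (dot _ (D 2 s)) (dh s) => y z e1 e2.
  (* Differentiating [h (1 + h) = 0] gives [h' (1 + 2 h) = 0]. The factor [1 + 2 h] is invertible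
     because [(1 + 2 h)^2 = 1 + 4 h (1 + h) = 1]; the identity below encodes this with [y = h] and
     [z = h']. *)
  have -> : z =
      (y * (0 + z) + (1 + y) * z) * (2 * y + 1) - 4 * z * (y * (1 + y)).
    by ring.
  by rewrite [X in X * _]e1 e2 mul0r mulr0 subr0.
have [[s Is] _ _] := hI.
have Dh0 z : I z -> is_derive z 1 h 0.
  by move=> Iz; apply: is_derive_eq (Dh z Iz) (dh0 z Iz).
have hc x : I x -> h x = h s.
  by move=> Ix; exact: is_derive0_cst itvI Dh0 x s Ix Is.
have /eqP := hh s Is; rewrite mulf_eq0 => /orP[/eqP e|].
  by left=> x Ix; rewrite (hc x Ix).
by rewrite addrC addr_eq0 => /eqP e; right=> x Ix; rewrite (hc x Ix).
Qed.

End UnitSpeedCurve.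

Theorem theorem2p1 (R : realType) (I : set R) (alpha : R -> 'rV[R]_3)
    (hI : open_interval I) (hsmooth : smooth_on I alpha)
    (hspeed : unit_speed I alpha) (hcurv : positive_curvature I alpha) :
  (rectifying_curve I alpha \/
   exists r : R, 0 < r /\ alpha @` I `<=` origin_sphere r)
  <->
  exists c : R, c != 0 /\
    forall s, I s -> enorm (crossmul (alpha s) (derive1 alpha s)) = c.
Proof.
have [[s0 Is0] oI itvI] := hI.
have rectE := rectifyingE hI hsmooth hspeed hcurv.
split=> [[/rectE h0|[r [r0 sph]]]|[c [c0 cst]]].
- pose c := enorm (crossmul (alpha s0) (derive1 alpha s0)).
  have cst s : I s -> enorm (crossmul (alpha s) (derive1 alpha s)) = c.
    move=> Is; apply: (enorm_cross_cst hI hsmooth hspeed _ Is Is0) => x Ix.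
    by rewrite (h0 x Ix) mulr0.
  exists c; split=> //; apply/eqP => c0.
  apply: (rectifying_enorm_cross_neq0 hI hsmooth hspeed hcurv h0) => s Is.
  by rewrite -c0; exact: cst.
(* On a sphere, differentiating [|alpha|^2 = r^2] gives [g = 0], so the magnitude is the radius [r]
   itself. *)
- have aa s : I s ->
      dot (derive1n 0 alpha s) (derive1n 0 alpha s) = r ^+ 2.
    by move=> Is; rewrite -sqr_enorm [enorm _]sph //; exists s.
  exists r; split; first by rewrite gt_eqF.
  move=> s Is; apply: enorm_eq (ltW r0) _.
  apply: etrans (enorm_cross hspeed Is) _; rewrite (aa s Is).
  have := derive_cst_on oI aa Is (is_derive_dot_derive1n hsmooth 0 0 Is).
  rewrite (dotC (derive1n 1 alpha s)) -mulr2n => /eqP.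
  by rewrite mulrn_eq0 /= => /eqP ->; rewrite expr0n subr0.
- have F2 s : I s -> dot (derive1n 0 alpha s) (derive1n 0 alpha s)
      - dot (derive1n 0 alpha s) (derive1n 1 alpha s) ^+ 2 = c ^+ 2.
    by move=> Is; rewrite -(enorm_cross hspeed Is) [enorm _](cst s Is).
  have gh0 s : I s -> dot (derive1n 0 alpha s) (derive1n 1 alpha s)
                      * dot (derive1n 0 alpha s) (derive1n 2 alpha s) = 0.
    move=> Is; have Dc := is_derive_sqr_enorm_cross hsmooth hspeed Is.
    have /eqP := derive_cst_on oI F2 Is Dc.
    by rewrite oppr_eq0 mulf_eq0 pnatr_eq0 => /eqP.
  have [/rectE|h1] := acceleration_component_cst hI hsmooth hspeed gh0.
    by left.
  (* With [h = -1], the equation [g h = 0] forces [g = 0], so [|alpha|^2 = c^2]. Being a norm, the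
     nonzero [c] is positive and serves as the radius. *)
  have rad s : I s -> enorm (alpha s) = c.
    move=> Is; apply: enorm_eq; first by rewrite -(cst s Is) enorm_ge0.
    rewrite -(F2 s Is) sqr_enorm; have /eqP := gh0 s Is.
    by rewrite (h1 s Is) mulrN1 oppr_eq0 => /eqP ->; rewrite expr0n subr0.
  right; exists c; split; first by rewrite lt0r c0 -(rad s0 Is0) enorm_ge0.
  by move=> _ [s Is <-]; exact: rad.
Qed.
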